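(* The diversity-multiplexing gain tradeoff (DMT) of the Incomplete DF protocol is $$d^*(r) = (1-r)^+ + N(1-2r)^+,$$ where $N$ is the number of relays in the network, $r$ is the multiplexing gain, and $x^+=\max(x,0)$.
   Context: **Channel model.** There are one source, $N$ relays and one destination. The channel coefficients $g_0$ (source-destination), $h_n$ (source-relay $n$) and $g_n$ (relay $n$-destination), $n=1,\dots,N$, are mutually independent. All are Rayleigh fading with the same average SNR: they are circularly symmetric complex Gaussian with unit variance, so $|g_0|^2,|g_n|^2,|h_n|^2$ are independent exponential random variables of mean $1$. The number $\rho$ is the signal-to-noise ratio and $R$ is the spectral efficiency. $\log$ is to a fixed base $>1$, the same everywhere. **Incomplete DF protocol and its outage probability.** The source-relay link of relay $n$ is in outage if $\log(1+\rho|h_n|^2)<2R$. Let $S\subseteq\{1,\dots,N\}$ be the (random) set of relays whose source-relay link is not in outage, and let $N_u=|S|$. - If $N_u\ge1$, the cooperative scheme with the $N_u$ relays of $S$ is used. Its equivalent channel matrix is the $2N_u\times 2N_u$ block-diagonal matrix $\mathbf H$ with diagonal blocks $$\mathbf H_n=\begin{bmatrix} g_0 & 0\\ \frac{g_n}{\sqrt2} & \frac{g_0}{\sqrt2}\end{bmatrix},\quad n\in S.$$ Its instantaneous capacity is $C(\mathbf H)=\frac{1}{2N_u}\log\det(\mathbf I+\rho\,\mathbf H\mathbf H^\dagger)$, where $\dagger$ denotes the conjugate transpose. The protocol is in outage if $C(\mathbf H)<R$. - If $N_u=0$, direct (non-cooperative) transmission is used, and the protocol is in outage if $\log(1+\rho|g_0|^2)<R$.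 $Pr_{\mathrm{out}}(R)$ denotes the probability, at signal-to-noise ratio $\rho$, that the protocol is in outage at spectral efficiency $R$. **Diversity-multiplexing gain tradeoff.** A diversity gain $d^*(r)$ is achieved at a multiplexing gain $r$ if $$\lim_{\rho\to\infty}\frac{\log Pr_{\mathrm{out}}(r\log\rho)}{\log\rho}=-d^*(r).$$
   Formalization: The multiplexing gain r is taken strictly positive: at r = 0 the spectral efficiency is 0, the outage probability is exactly 0, its logarithm is −∞, and the stated value 1 + N is not attained under the given definition. *)

(* Defs.v *)
From HB Require Import structures.
From mathcomp Require Import all_boot all_order all_algebra.
From mathcomp Require Import complex.
From mathcomp Require Import all_classical all_reals all_analysis.

Set Implicit Arguments.
Unset Strict Implicit.
Unset Printing Implicit Defensive.

Import Order.TTheory GRing.Theory Num.Theory.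
Import numFieldNormedType.Exports.

Local Open Scope classical_set_scope.
Local Open Scope complex_scope.
Local Open Scope ring_scope.

Definition logb {R : realType} (b x : R) : R := ln x / ln b.

(* [elogb b 0 = -oo], so a vanishing outage probability is not given a junk
   finite logarithm. *)
Definition elogb {R : realType} (b : R) (x : \bar R) : \bar R :=
  (lne x * ((ln b)^-1)%:E)%E.

(* The measurable structure on the complex numbers is the Borel structure of
   the plane, through this identification. *)
Definition cplx_pair {R : realType} (z : R[i]) :
    measurableTypeR R * measurableTypeR R :=
  (complex.Re z, complex.Im z).

Definition sqmod {R : realType} (z : R[i]) : R :=
  complex.Re z ^+ 2 + complex.Im z ^+ 2.

Definition mutually_independent {R : realType} {d d' : measure_display}
    {Omega : measurableType d} {T : measurableType d'}
    (P : probability Omega R) (I : finType) (X : I -> Omega -> T) : Prop :=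
  forall (J : {set I}) (A : I -> set T),
    (forall i, i \in J -> measurable (A i)) ->
    (P (\bigcap_(i in [set` J]) (X i @^-1` A i)) =
     \prod_(i in J) P (X i @^-1` A i))%E.

(* Circularly symmetric complex Gaussian law of unit variance: i.i.d. real and
   imaginary parts, centered, of variance 1/2 each.  The second argument of
   [normal_prob] is the standard deviation. *)
Definition std_complex_gaussian {R : realType} {d : measure_display}
    {Omega : measurableType d} (P : probability Omega R)
    (Z : Omega -> R[i]) : Prop :=
  measurable_fun setT (cplx_pair \o Z) /\
  forall A : set (measurableTypeR R * measurableTypeR R), measurable A ->
    pushforward P (cplx_pair \o Z) A =
    (normal_prob (0 : R) (Num.sqrt 2^-1) \x
     normal_prob (0 : R) (Num.sqrt 2^-1))%E A.

Definition channel_coef {R : realType} {Omega : Type} (N : nat)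
    (g0 : Omega -> R[i]) (h g : 'I_N -> Omega -> R[i])
    (k : option ('I_N + 'I_N)) : Omega -> R[i] :=
  match k with
  | None => g0
  | Some (inl n) => h n
  | Some (inr n) => g n
  end.

Definition rayleigh_channel {R : realType} {d : measure_display}
    {Omega : measurableType d} (P : probability Omega R) (N : nat)
    (g0 : Omega -> R[i]) (h g : 'I_N -> Omega -> R[i]) : Prop :=
  (forall k, std_complex_gaussian P (channel_coef g0 h g k)) /\
  mutually_independent P (fun k => cplx_pair \o channel_coef g0 h g k).

Definition relay_block {R : realType} (g0 gn : R[i]) : 'M[R[i]]_2 :=
  \matrix_(i < 2, j < 2)
    if i == 0 then (if j == 0 then g0 else 0)
    else (if j == 0 then gn / (Num.sqrt 2)%:C else g0 / (Num.sqrt 2)%:C).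

(* The size [\sum_(k < #|S|) 2] is that of a block diagonal matrix with #|S|
   blocks of size 2; the blocks are listed in the enumeration order of S. *)
Definition coop_matrix {R : realType} (N : nat) (S : {set 'I_N})
    (g0 : R[i]) (g : 'I_N -> R[i]) : 'M[R[i]]_(\sum_(k < #|S|) 2) :=
  \mxdiag_(k < #|S|) relay_block g0 (g (enum_val k)).

(* The determinant is that of a Hermitian positive definite matrix (for
   [0 <= rho]), hence a positive real, and [complex.Re] is only a cast. *)
Definition coop_capacity {R : realType} (b rho : R) (N : nat) (S : {set 'I_N})
    (g0 : R[i]) (g : 'I_N -> R[i]) : R :=
  let H := coop_matrix S g0 g in
  (2 * #|S|%:R)^-1 *
  logb b (complex.Re (\det (1%:M + rho%:C *: (H *m map_mx conjc H^T)))).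

Definition decoding_relays {R : realType} (b rho Rs : R) (N : nat)
    (h : 'I_N -> R[i]) : {set 'I_N} :=
  finset (fun n => ~~ (logb b (1 + rho * sqmod (h n)) < 2 * Rs)).

Definition idf_outage {R : realType} (b rho Rs : R) (N : nat)
    (g0 : R[i]) (h g : 'I_N -> R[i]) : bool :=
  let S := decoding_relays b rho Rs h in
  if #|S| == 0%N then logb b (1 + rho * sqmod g0) < Rs
  else coop_capacity b rho S g0 g < Rs.

Definition idf_outage_prob {R : realType} {d : measure_display}
    {Omega : measurableType d} (P : probability Omega R) (b : R) (N : nat)
    (g0 : Omega -> R[i]) (h g : 'I_N -> Omega -> R[i]) (rho Rs : R) : \bar R :=
  P [set w | idf_outage b rho Rs (g0 w) (fun n => h n w) (fun n => g n w)].

(* [Pout rho Rs] is the outage probability at signal-to-noise ratio rho and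
   spectral efficiency Rs. *)
Definition achieves_diversity {R : realType} (b : R) (Pout : R -> R -> \bar R)
    (r dgain : R) : Prop :=
  (elogb b (Pout rho (r * logb b rho)%R) * ((logb b rho)^-1)%:E)%E
    @[rho --> +oo%R] --> (- dgain)%:E.

(* Main.v *)
(* Since det (I + rho H_n H_n^dagger) = (1 + rho |g_0|^2) (1 + rho |g_0|^2 / 2)
   + rho |g_n|^2 / 2, an outage with set S of decoding relays forces
   |g_0|^2 < 2 rho^(r - 1), and also prod_n (1 + rho |x_n|^2 / 2) <= rho^(2 r N)
   where x_n is g_n for n in S and h_n otherwise: a relay costs the same
   exponent whether its source link or its destination link is weak.  The law
   of |x|^2 gives [0, t[ a mass of order t near 0, so, after a union bound over
   finitely many ways of sharing the exponent 2 r N between the links,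
   independence gives Pr_out <= A rho^(- d + N / m) for every m > 0.
   Conversely, the event that no relay decodes and the direct link fails has
   probability at least A rho^(- d). *)
Require Import Defs.
From HB Require Import structures.
From mathcomp Require Import all_boot all_order all_algebra.
From mathcomp Require Import complex.
From mathcomp Require Import all_classical all_reals all_analysis.
From mathcomp Require Import measurable_realfun ring lra.

Set Implicit Arguments.
Unset Strict Implicit.
Unset Printing Implicit Defensive.

Import Order.TTheory GRing.Theory Num.Theory.
Import numFieldNormedType.Exports.

Local Open Scope ring_scope.
Local Open Scope classical_set_scope.

(** * Block diagonal determinants and the cooperative capacity *)

Lemma mul_mxdiag (R : pzRingType) (k : nat) (p_ : 'I_k -> nat)
    (A B : forall i, 'M[R]_(p_ i)) :
  mxdiag A *m mxdiag B = mxdiag (fun i => A i *m B i).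
Proof.
rewrite {2}/mxdiag mul_mxdiag_mxblock /mxdiag; apply: eq_mxblock => i j.
case: eqP => [ij|_]; last by rewrite mulmx0.
by case: _ / ij; rewrite !conform_mx_id.
Qed.

Lemma scale_mxdiag (R : pzRingType) (k : nat) (p_ : 'I_k -> nat)
    (a : R) (A : forall i, 'M[R]_(p_ i)) :
  a *: mxdiag A = mxdiag (fun i => a *: A i).
Proof.
rewrite -mul_scalar_mx -mxdiagZ mul_mxdiag.
by apply: eq_mxdiag => i; rewrite mul_scalar_mx.
Qed.

Lemma map_mxdiag (R S : nmodType) (f : {additive R -> S}) (k : nat)
    (p_ : 'I_k -> nat) (A : forall i, 'M[R]_(p_ i)) :
  map_mx f (mxdiag A) = mxdiag (fun i => map_mx f (A i)).
Proof.
apply/matrixP => i j; rewrite !mxE.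
case: eqP => [ij|_]; last by rewrite !mxE raddf0.
move: (tagnat.sig2 j); case: _ / ij => l.
by rewrite !conform_mx_id mxE.
Qed.

Lemma det_mxdiag (R : comPzRingType) (k : nat) (p_ : 'I_k -> nat)
    (A : forall i, 'M[R]_(p_ i)) :
  \det (mxdiag A) = \prod_i \det (A i).
Proof.
(* The size of a block diagonal matrix is a sum, equal to 0 for no block only up to rewriting, and
   [mxdiag_recl] introduces a cast: hence these two transport facts. *)
have det0 n (M : 'M[R]_n) : n = 0%N -> \det M = 1.
  by move=> n0; subst n; rewrite det_mx00.
have det_cast m n (e : m = n) (M : 'M[R]_m) : \det (castmx (e, e) M) = \det M.
  by subst n; rewrite castmx_id.
elim: k p_ A => [|k IH] p_ A; first by rewrite det0 big_ord0.
by rewrite mxdiag_recl det_cast det_ublock IH big_ord_recl.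
Qed.

Lemma det_mx22 (R : comPzRingType) (A : 'M[R]_2) :
  \det A = A 0 0 * A 1 1 - A 0 1 * A 1 0.
Proof.
rewrite (expand_det_row _ ord0) !big_ord_recl big_ord0 /cofactor !det_mx11 !mxE.
have -> : lift ord0 0 = 1 :> 'I_2 by apply/val_inj.
have -> : lift 1 0 = 0 :> 'I_2 by apply/val_inj.
by rewrite /= expr0 expr1 mul1r mulN1r addr0 mulrN.
Qed.

Definition relay_det {R : realType} (rho : R) (z w : R[i]) : R :=
  (1 + rho * sqmod z) * (1 + rho * sqmod z / 2) + rho * sqmod w / 2.

(** The term [rho^2 |z|^2 |w|^2 / 2] of the diagonal product cancels against the off-diagonal
    product, which leaves [w] only in a separate additive term. *)
Lemma det_relay_block (R : realType) (rho : R) (z w : R[i]) :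
  \det (1%:M +
        rho%:C *: (relay_block z w *m map_mx conjc (relay_block z w)^T))%C
  = ((relay_det rho z w)%:C)%C.
Proof.
rewrite det_mx22 !mxE !big_ord_recl !big_ord0 !mxE /= -!fmorphV /=.
(* Once the inverse root is abstracted, its square being [1/2] is all that makes the identity
   polynomial, within reach of [ring]. *)
have s2 : (Num.sqrt 2)^-1 * (Num.sqrt 2)^-1 = 2^-1 :> R.
  by rewrite -invfM -expr2 sqr_sqrtr.
move: (Num.sqrt 2)^-1 s2 => s s2.
rewrite /relay_det /sqmod; case: z => x y; case: w => u v /=.
simpc; apply/eqP; rewrite eq_complex /=; apply/andP; split; apply/eqP.
  by ring: s2.
by ring.
Qed.

Lemma relay_det_gt0 (R : realType) (rho : R) (z w : R[i]) :
  0 <= rho -> 0 < relay_det rho z w.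
Proof.
move=> rho0; rewrite /relay_det.
have z0 : 0 <= rho * sqmod z by rewrite mulr_ge0// addr_ge0// sqr_ge0.
have w0 : 0 <= rho * sqmod w by rewrite mulr_ge0// addr_ge0// sqr_ge0.
by nra.
Qed.

(** The identity matrix is block diagonal too, so the determinant factors over the blocks; every
    factor is real, so the cast by [complex.Re] disappears. *)
Lemma coop_capacityE (R : realType) (b rho : R) (N : nat) (S : {set 'I_N})
    (g0 : R[i]) (g : 'I_N -> R[i]) :
  coop_capacity b rho S g0 g =
  (2 * #|S|%:R)^-1 * logb b (\prod_(n in S) relay_det rho g0 (g n)).
Proof.
rewrite /coop_capacity /coop_matrix tr_mxdiag map_mxdiag mul_mxdiag.
rewrite scale_mxdiag.
rewrite -mxdiagZ -mxdiagD det_mxdiag.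
under eq_bigr => k _ do rewrite det_relay_block.
by rewrite -rmorph_prod /= [in RHS]big_enum_val.
Qed.

(** At a spectral efficiency proportional to [logb b rho], the factor [ln b] cancels and capacity
    conditions become comparisons with powers of [rho], free of the base. *)
Lemma logb_ltP (R : realType) (b rho x q : R) : 1 < b -> 0 < rho -> 0 < x ->
  (logb b x < q * logb b rho) = (x < rho `^ q).
Proof.
move=> b1 rho0 x0; rewrite /logb mulrA ltr_pM2r ?invr_gt0 ?ln_gt0//.
by rewrite -ln_powR ltr_ln ?posrE ?powR_gt0.
Qed.

Lemma coop_capacity_ltP (R : realType) (b rho r : R) (N : nat) (S : {set 'I_N})
    (g0 : R[i]) (g : 'I_N -> R[i]) : 1 < b -> 0 < rho -> #|S| != 0%N ->
  (coop_capacity b rho S g0 g < r * logb b rho) =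
  (\prod_(n in S) relay_det rho g0 (g n) < rho `^ (2 * r * #|S|%:R)).
Proof.
move=> b1 rho0 S0; have S1 : 0 < #|S|%:R :> R by rewrite ltr0n lt0n.
rewrite coop_capacityE -(@logb_ltP _ b) //; last first.
  by apply: prodr_gt0 => n _; rewrite relay_det_gt0 ?ltW.
rewrite mulrC ltr_pdivrMr ?mulr_gt0//; congr (_ < _).
by ring.
Qed.

(** * Gaussian mass of small discs *)

Lemma normal_prob_itv_le (R : realType) (s t : R) : s != 0 -> 0 <= t ->
  (normal_prob 0%R s `](- t)%R, t[%classic <= (2 * normal_peak s * t)%:E)%E.
Proof.
move=> s0 t0; rewrite /normal_prob.
apply: (@le_trans _ _
    (\int[lebesgue_measure]_(x in `](- t)%R, t[) (normal_peak s)%:E)%E).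
  apply: ge0_le_integral => //=.
  - by move=> x _; rewrite lee_fin normal_pdf_ge0.
  - apply/measurable_EFinP; apply: measurable_funTS.
    exact: measurable_normal_pdf.
  - by move=> x _; rewrite lee_fin normal_pdf_ub.
rewrite integral_cst//= lebesgue_measure_itv/= lte_fin.
case: ifPn => _; last by rewrite mule0 lee_fin !mulr_ge0// normal_peak_ge0.
by rewrite -EFinB -EFinM lee_fin; lra.
Qed.

(** For [t <= 1] the interval lies in [[-1, 1]], where the density is at least its value at 1; that
    value is the constant here. *)
Lemma normal_prob_itv_ge (R : realType) (s t : R) : s != 0 -> 0 <= t <= 1 ->
  ((2 * (normal_peak s * expR (- (s ^+ 2 *+ 2)^-1)) * t)%:E
   <= normal_prob 0%R s `](- t)%R, t[%classic)%E.
Proof.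
move=> s0 /andP[t0 t1]; rewrite /normal_prob.
set c := (_ * expR _).
apply: (@le_trans _ _
    (\int[lebesgue_measure]_(x in `](- t)%R, t[) c%:E)%E).
  rewrite integral_cst//= lebesgue_measure_itv/= lte_fin.
  case: ltP => tt.
    by rewrite -EFinB -EFinM lee_fin; lra.
  have -> : t = 0 by lra.
  by rewrite mulr0 mule0.
have c0 : 0 <= c by rewrite mulr_ge0 ?normal_peak_ge0 ?expR_ge0.
apply: ge0_le_integral => //=.
- apply/measurable_EFinP; apply: measurable_funTS.
  exact: measurable_normal_pdf.
- move=> x; rewrite in_itv/= => /andP[x1 x2].
  rewrite lee_fin normal_pdfE// ler_pM2l ?normal_peak_gt0// /normal_fun.
  rewrite ler_expR subr0 mulNr lerN2 ler_piMl ?invr_ge0 ?mulrn_wge0 ?sqr_ge0//.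
  by nra.
Qed.

Lemma measurable_eqb (d : measure_display) (T : measurableType d)
    (f : T -> bool) (c : bool) :
  measurable_fun setT f -> measurable [set x | f x = c].
Proof.
move=> mf; have : measurable ([set: T] `&` f @^-1` [set c]) by exact: mf.
by rewrite setTI.
Qed.

Lemma measurable_set_bool (d : measure_display) (T : measurableType d)
    (f : T -> bool) : measurable_fun setT f -> measurable [set x | f x].
Proof. exact: measurable_eqb. Qed.

(** Indexed by the squared radius, so that the Gaussian mass is of order [t] near 0. *)
Definition disc {R : realType} (t : R) :
    set (measurableTypeR R * measurableTypeR R) :=
  [set p | p.1 ^+ 2 + p.2 ^+ 2 < t].

Lemma measurable_disc (R : realType) (t : R) : measurable (disc t).
Proof.
apply: measurable_set_bool; apply: measurable_fun_ltr => //.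
apply: measurable_funD; apply: measurable_funX.
- exact: measurable_fst.
- exact: measurable_snd.
Qed.

Definition std_gaussian2 {R : realType} :
    set (measurableTypeR R * measurableTypeR R) -> \bar R :=
  (normal_prob (0 : R) (Num.sqrt 2^-1) \x
   normal_prob (0 : R) (Num.sqrt 2^-1))%E.

(** The disc lies in the square of half-side [sqrt t], whose mass is a product of two interval
    masses of order [sqrt t]. *)
Lemma std_gaussian2_disc_le (R : realType) : exists2 C : R, 0 < C &
  forall t, 0 <= t -> (std_gaussian2 (disc t) <= (C * t)%:E)%E.
Proof.
set s := Num.sqrt 2^-1 : R.
have s0 : s != 0 by rewrite gt_eqF// sqrtr_gt0.
exists ((2 * normal_peak s) ^+ 2).
  by rewrite exprn_gt0// mulr_gt0// normal_peak_gt0.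
move=> t t0.
pose I : set (measurableTypeR R) := `]- Num.sqrt t, Num.sqrt t[.
apply: (@le_trans _ _ (std_gaussian2 (I `*` I))).
  apply: le_measure; rewrite ?inE.
  - exact: measurable_disc.
  - by apply: measurableX; exact: measurable_itv.
  - move=> [x y]; rewrite /disc /= => xy.
    by split; rewrite /I/= in_itv/= -ltr_norml -sqrtr_sqr ltr_sqrt; nra.
rewrite /std_gaussian2 product_measure1E; [|exact: measurable_itv..].
rewrite -[X in (_ * X)%:E](sqr_sqrtr t0) -exprMn expr2 EFinM.
by apply: lee_pmul => //; exact: normal_prob_itv_le.
Qed.

(** The disc contains the square of half-side [sqrt (t / 2)]; the halving accounts for the division
    by 2 in the constant. *)
Lemma std_gaussian2_disc_ge (R : realType) : exists2 c : R, 0 < c &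
  forall t, 0 <= t <= 1 -> ((c * t)%:E <= std_gaussian2 (disc t))%E.
Proof.
set s := Num.sqrt 2^-1 : R.
have s0 : s != 0 by rewrite gt_eqF// sqrtr_gt0.
pose k := 2 * (normal_peak s * expR (- (s ^+ 2 *+ 2)^-1)).
have k0 : 0 < k by rewrite !mulr_gt0 ?normal_peak_gt0 ?expR_gt0.
exists (k ^+ 2 / 2); first by rewrite divr_gt0 ?exprn_gt0.
move=> t /andP[t0 t1].
have t20 : 0 <= t / 2 by lra.
pose u := Num.sqrt (t / 2).
have u2 : u ^+ 2 = t / 2 by rewrite sqr_sqrtr.
have u0 : 0 <= u by rewrite sqrtr_ge0.
pose I : set (measurableTypeR R) := `]- u, u[.
apply: (@le_trans _ _ (std_gaussian2 (I `*` I))); last first.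
  apply: le_measure; rewrite ?inE.
  - by apply: measurableX; exact: measurable_itv.
  - exact: measurable_disc.
  - move=> [x y]; rewrite /disc /I /= !in_itv/= => -[].
    by move=> /andP[? ?] /andP[? ?]; nra.
rewrite /std_gaussian2 product_measure1E; [|exact: measurable_itv..].
rewrite -mulrA [_ * t]mulrC -u2 -exprMn expr2 EFinM.
have u01 : 0 <= u <= 1 by rewrite u0/=; nra.
have ku : ((k * u)%:E <= normal_prob 0%R s I)%E.
  exact: normal_prob_itv_ge.
have ku0 : (0 <= (k * u)%:E)%E by rewrite lee_fin mulr_ge0// ltW.
exact: lee_pmul.
Qed.

(** * Independence and the joint probability of weak links *)

Lemma rayleigh_prob_rectangle (R : realType) (d : measure_display)
    (Omega : measurableType d) (P : probability Omega R) (N : nat)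
    (g0 : Omega -> R[i]) (h g : 'I_N -> Omega -> R[i])
    (A : option ('I_N + 'I_N) -> set (measurableTypeR R * measurableTypeR R)) :
  rayleigh_channel P g0 h g -> (forall k, measurable (A k)) ->
  P [set w | forall k, A k (cplx_pair (channel_coef g0 h g k w))] =
  (\prod_k std_gaussian2 (A k))%E.
Proof.
move=> [gauss indep] mA.
have GE k : P ((cplx_pair \o channel_coef g0 h g k) @^-1` A k) =
    std_gaussian2 (A k) by have [_] := gauss k; exact.
have := indep [set: option ('I_N + 'I_N)]%SET A (fun k _ => mA k).
rewrite (eq_bigr _ (fun k _ => GE k)).
rewrite (eq_bigl xpredT); last by move=> k; rewrite inE.
move=> <-; congr (P _); apply/seteqP; split=> w /= H k => [_|]; first exact: H.
by apply: H => /=; rewrite inE.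
Qed.

(** The common shape of the events in both bounds: the upper bound covers the outage by such events,
    the lower bound places the one with [S] empty inside the outage. *)
Definition relay_discs {R : realType} {Omega : Type} (N : nat)
    (g0 : Omega -> R[i]) (h g : 'I_N -> Omega -> R[i])
    (S : {set 'I_N}) (t0 : R) (t : 'I_N -> R) : set Omega :=
  [set w | sqmod (g0 w) < t0 /\
     forall n, sqmod (if n \in S then g n w else h n w) < t n].

Lemma measurable_sqmod (R : realType) (d : measure_display)
    (Omega : measurableType d) (P : probability Omega R) (Z : Omega -> R[i]) :
  std_complex_gaussian P Z -> measurable_fun setT (fun w => sqmod (Z w)).
Proof.
move=> [mZ _]; apply: measurable_funD; apply: measurable_funX.
- by apply: (measurableT_comp measurable_fst mZ).
- by apply: (measurableT_comp measurable_snd mZ).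
Qed.

Lemma measurable_relay_discs (R : realType) (d : measure_display)
    (Omega : measurableType d) (P : probability Omega R) (N : nat)
    (g0 : Omega -> R[i]) (h g : 'I_N -> Omega -> R[i])
    (S : {set 'I_N}) (t0 : R) (t : 'I_N -> R) :
  rayleigh_channel P g0 h g -> measurable (relay_discs g0 h g S t0 t).
Proof.
move=> [gauss _].
rewrite (_ : relay_discs _ _ _ _ _ _ = [set w | sqmod (g0 w) < t0] `&`
    \bigcap_(n in [set: 'I_N])
      [set w | sqmod (if n \in S then g n w else h n w) < t n]); last first.
  apply/seteqP; split=> w /= [H1 H2]; split=> // n.
    by move=> _; exact: H2.
  exact: H2.
apply: measurableI.
  apply: measurable_set_bool; apply: measurable_fun_ltr => //.
  exact: measurable_sqmod (gauss None).
apply: fin_bigcap_measurable => [|n _]; first exact: finite_finset.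
apply: measurable_set_bool.
apply: measurable_fun_ltr => //; case: (n \in S).
- exact: measurable_sqmod (gauss (Some (inr n))).
- exact: measurable_sqmod (gauss (Some (inl n))).
Qed.

Lemma std_gaussian2_setT (R : realType) : std_gaussian2 [set: R * R] = 1%E.
Proof.
rewrite -setXTT /std_gaussian2 product_measure1E//.
have nT : normal_prob 0 (Num.sqrt 2^-1) [set: R] = 1%E.
  exact: (@probability_setT _ _ _ (normal_prob 0 (Num.sqrt 2^-1))).
by rewrite [X in (X * X)%E]nT mule1.
Qed.

Lemma std_gaussian2_disc_fin (R : realType) (t : R) :
  std_gaussian2 (disc t) \is a fin_num.
Proof.
rewrite ge0_fin_numE; last exact: measure_ge0.
apply: (@le_lt_trans _ _ (std_gaussian2 [set: R * R])).
  by apply: le_measure; rewrite ?inE//; exact: measurable_disc.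
by rewrite std_gaussian2_setT ltry.
Qed.

Definition gaussian_disc {R : realType} (t : R) : R :=
  fine (std_gaussian2 (disc t)).

(** The unconstrained link of each relay ranges over the whole plane, of mass 1, so each relay
    contributes one disc factor and the value does not depend on [S]. *)
Lemma rayleigh_prob_relay_discs (R : realType) (d : measure_display)
    (Omega : measurableType d) (P : probability Omega R) (N : nat)
    (g0 : Omega -> R[i]) (h g : 'I_N -> Omega -> R[i])
    (S : {set 'I_N}) (t0 : R) (t : 'I_N -> R) :
  rayleigh_channel P g0 h g ->
  P (relay_discs g0 h g S t0 t) =
  (gaussian_disc t0 * \prod_n gaussian_disc (t n))%:E.
Proof.
move=> ch.
pose A (k : option ('I_N + 'I_N)) := match k with
  | None => disc t0
  | Some (inl n) => if n \in S then setT else disc (t n)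
  | Some (inr n) => if n \in S then disc (t n) else setT
  end.
rewrite (_ : relay_discs _ _ _ _ _ _ =
    [set w | forall k, A k (cplx_pair (channel_coef g0 h g k w))]); last first.
  apply/seteqP; split=> w /=.
  - move=> [H1 H2] [[n|n]|] //=; have := H2 n; case: ifP => //=.
  - move=> H; split; first exact: (H None).
    move=> n; have := H (Some (inl n)); have := H (Some (inr n)) => /=.
    by case: ifP.
rewrite rayleigh_prob_rectangle //; last first.
  by move=> [[n|n]|] /=; try case: ifP => _; try exact: measurable_disc.
(* The direct link is split off, then the product over the sum type is regrouped so that the two
   links of one relay face each other. *)
rewrite (bigD1 None)//= (reindex_omap Some id) => [|[]//].
rewrite (eq_bigl xpredT); last by move=> k; rewrite /= eqxx.
rewrite big_sumType/= -big_split/= EFinM -prodEFin.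
congr (_ * _)%E; first by rewrite fineK// std_gaussian2_disc_fin.
apply: eq_bigr => n _; rewrite fineK ?std_gaussian2_disc_fin//.
by case: ifP; rewrite std_gaussian2_setT ?mul1e ?mule1.
Qed.

Lemma gaussian_disc_ge0 (R : realType) (t : R) : 0 <= gaussian_disc t.
Proof. by apply: fine_ge0; exact: measure_ge0. Qed.

Lemma gaussian_disc_le (R : realType) : exists2 C : R, 0 < C &
  forall t, 0 <= t -> gaussian_disc t <= C * t.
Proof.
have [C C0 CP] := std_gaussian2_disc_le R; exists C => // t t0.
by rewrite -lee_fin fineK ?std_gaussian2_disc_fin//; exact: CP.
Qed.

Lemma gaussian_disc_ge (R : realType) : exists2 c : R, 0 < c &
  forall t, 0 <= t <= 1 -> c * t <= gaussian_disc t.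
Proof.
have [c c0 cP] := std_gaussian2_disc_ge R; exists c => // t t0.
by rewrite -lee_fin fineK ?std_gaussian2_disc_fin//; exact: cP.
Qed.

Lemma gaussian_disc_mono (R : realType) :
  {homo @gaussian_disc R : s t / s <= t}.
Proof.
move=> s t st; apply: fine_le; rewrite ?std_gaussian2_disc_fin//.
apply: le_measure; rewrite ?inE; try exact: measurable_disc.
by move=> p; rewrite /disc/= => /lt_le_trans; apply.
Qed.

(** * Outage conditions as inequalities between powers of the SNR *)

Lemma sqmod_ge0 (R : realType) (z : R[i]) : 0 <= sqmod z.
Proof. by rewrite addr_ge0// sqr_ge0. Qed.

Lemma snr_ge0 (R : realType) (rho : R) (z : R[i]) :
  0 < rho -> 0 <= rho * sqmod z.
Proof. by move=> rho0; rewrite mulr_ge0 ?sqmod_ge0 ?ltW. Qed.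

Lemma ln_prod (R : realType) (I : finType) (w : I -> R) :
  (forall i, 0 < w i) -> ln (\prod_i w i) = \sum_i ln (w i).
Proof.
move=> w0.
suff [] : 0 < \prod_i w i /\ ln (\prod_i w i) = \sum_i ln (w i) by [].
elim/big_rec2: _ => [|i x y _ [y0 <-]]; first by rewrite ln1.
by rewrite mulr_gt0// lnM ?posrE.
Qed.

Lemma notin_decoding_relays (R : realType) (b rho r : R) (N : nat)
    (h : 'I_N -> R[i]) n : 1 < b -> 1 < rho ->
  (n \notin decoding_relays b rho (r * logb b rho) h) =
  (1 + rho * sqmod (h n) < rho `^ (2 * r)).
Proof.
move=> b1 rho1; have rho0 : 0 < rho by rewrite (lt_trans ltr01).
by rewrite inE negbK mulrA logb_ltP// ltr_wpDr ?snr_ge0.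
Qed.

Lemma idf_outageE (R : realType) (b rho r : R) (N : nat)
    (z : R[i]) (h g : 'I_N -> R[i]) : 1 < b -> 1 < rho ->
  idf_outage b rho (r * logb b rho) z h g =
  let S := decoding_relays b rho (r * logb b rho) h in
  if #|S| == 0%N then 1 + rho * sqmod z < rho `^ r
  else \prod_(n in S) relay_det rho z (g n) < rho `^ (2 * r * #|S|%:R).
Proof.
move=> b1 rho1; have rho0 : 0 < rho by rewrite (lt_trans ltr01).
rewrite /idf_outage /=; case: eqP => [_|/eqP S0].
  by rewrite logb_ltP// ltr_wpDr ?snr_ge0.
exact: coop_capacity_ltP.
Qed.

(** The thresholds solve [1 + rho x < rho^q] for [x], with [q = r] on the direct link and [q = 2r]
    on the source links; the latter failures empty the decoding set and select direct
    transmission. *)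
Lemma idf_outage_no_decoding (R : realType) (b rho r : R) (N : nat)
    (z : R[i]) (h g : 'I_N -> R[i]) : 1 < b -> 1 < rho ->
  sqmod z < (rho `^ r - 1) / rho ->
  (forall n, sqmod (h n) < (rho `^ (2 * r) - 1) / rho) ->
  idf_outage b rho (r * logb b rho) z h g.
Proof.
move=> b1 rho1 z1 h1; have rho0 : 0 < rho by rewrite (lt_trans ltr01).
rewrite idf_outageE//=.
have -> : decoding_relays b rho (r * logb b rho) h = finset.set0.
  apply/setP => n; rewrite [in RHS]inE; apply/negbTE.
  rewrite notin_decoding_relays//.
  by have := h1 n; rewrite ltr_pdivlMr//; lra.
by rewrite cards0 eqxx; move: z1; rewrite ltr_pdivlMr//; lra.
Qed.

(** Each block determinant is at least [(1 + rho |z|^2 / 2)^2], so cooperation in outage forces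
    [1 + rho |z|^2 / 2 < rho^r]; the factor 2 comes from this half. Direct transmission in outage
    gives more. *)
Lemma idf_outage_direct_link (R : realType) (b rho r : R) (N : nat)
    (z : R[i]) (h g : 'I_N -> R[i]) : 1 < b -> 1 < rho ->
  idf_outage b rho (r * logb b rho) z h g -> sqmod z < 2 * rho `^ (r - 1).
Proof.
move=> b1 rho1; have rho0 : 0 < rho by rewrite (lt_trans ltr01).
have z0 : 0 <= rho * sqmod z by exact: snr_ge0.
have powr0 : 0 < rho `^ r by exact: powR_gt0.
rewrite powRB; last by rewrite (gt_eqF rho0); apply/implyP.
rewrite powRr1 ?(ltW rho0)// mulrA ltr_pdivlMr// [_ * rho]mulrC.
rewrite idf_outageE//=; set S := decoding_relays _ _ _ _.
case: eqP => [_|/eqP S0 H]; first by lra.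
have : (1 + rho * sqmod z / 2) ^+ 2 < rho `^ (2 * r).
  (* Raising to the power [#|S|], strictly monotone as [S] is nonempty, turns the left side into a
     constant product over [S], comparable factor by factor. *)
  rewrite -(ltr_pXn2r (n := #|S|)) ?nnegrE ?lt0n ?powR_ge0//; last first.
    by rewrite exprn_ge0//; lra.
  rewrite -[X in _ < X]powR_mulrn ?powR_ge0// -powRrM.
  apply: le_lt_trans H; rewrite -prodr_const; apply: ler_prod => n _.
  have w0 : 0 <= rho * sqmod (g n) by exact: snr_ge0.
  by rewrite sqr_ge0 /relay_det /=; nra.
rewrite [2 * r]mulrC powRrM powR_mulrn ?powR_ge0//.
rewrite ltr_pXn2r ?nnegrE ?powR_ge0//; lra.
Qed.

(** The half is forced by the block determinant for [g n]; keeping it for [h n] only weakens the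
    bound and treats both kinds of link alike. *)
Definition relay_link {R : realType} (rho : R) (N : nat) (S : {set 'I_N})
    (h g : 'I_N -> R[i]) (n : 'I_N) : R :=
  1 + rho * sqmod (if n \in S then g n else h n) / 2.

(** Over [S] each factor is below its block determinant, so the outage bounds the product; outside
    [S] each factor is below [rho^(2r)] by the failure to decode. The two exponents add up through
    [#|S| + #|~: S| = N]. *)
Lemma idf_outage_relay_links (R : realType) (b rho r : R) (N : nat)
    (z : R[i]) (h g : 'I_N -> R[i]) : 1 < b -> 1 < rho ->
  idf_outage b rho (r * logb b rho) z h g ->
  \prod_n relay_link rho (decoding_relays b rho (r * logb b rho) h) h g n
    <= rho `^ (2 * r * N%:R).
Proof.
move=> b1 rho1; have rho0 : 0 < rho by rewrite (lt_trans ltr01).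
have z0 : 0 <= rho * sqmod z by exact: snr_ge0.
have link1 S n : 1 <= relay_link rho S h g n.
  by rewrite lerDl mulr_ge0// snr_ge0.
rewrite idf_outageE//=; set S := decoding_relays _ _ _ _ => H.
have prodS : \prod_(n in S) relay_link rho S h g n <= rho `^ (2 * r * #|S|%:R).
  move: H; case: eqP => [S0 _|_ H].
    rewrite S0 mulr0 powRr0 big_pred0// => n.
    by apply/negbTE; rewrite (cards0_eq S0) inE.
  apply: le_trans (ltW H); apply: ler_prod => n nS.
  rewrite (le_trans ler01)//= /relay_link nS /relay_det.
  have w0 : 0 <= rho * sqmod (g n) by exact: snr_ge0.
  by nra.
have prodSC : \prod_(n in ~: S) relay_link rho S h g n
    <= rho `^ (2 * r * #|~: S|%:R).
  rewrite powRrM powR_mulrn ?powR_ge0// -prodr_const.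
  apply: ler_prod => n; rewrite inE => nS.
  rewrite (le_trans ler01)//= /relay_link (negbTE nS).
  move: nS; rewrite notin_decoding_relays//.
  have w0 : 0 <= rho * sqmod (h n) by exact: snr_ge0.
  by lra.
rewrite (bigID (mem S))/= -[X in 2 * r * X%:R](card_ord N) -(cardsC S).
rewrite natrD mulrDr powRD; last by rewrite (gt_eqF rho0); apply/implyP.
have link0 n : 0 <= relay_link rho S h g n by rewrite (le_trans ler01).
apply: ler_pM => //; try by apply: prodr_ge0 => n _.
rewrite (eq_bigl (fun n => n \in ~: S)); first exact: prodSC.
by move=> n; rewrite finset.in_setC.
Qed.

(** The shares [e n], which are [m] times the logarithm of [w n] to base [rho], are nonnegative with
    sum at most [q m]. Rounding down preserves the bound on the sum, and the [.+1] restores a strict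
    upper bound on each factor. *)
Lemma prod_powR_grid (R : realType) (N m : nat) (rho q : R) (w : 'I_N -> R) :
  (0 < m)%N -> 1 < rho -> (forall n, 1 <= w n) ->
  \prod_n w n <= rho `^ q ->
  exists i : {ffun 'I_N -> 'I_(Num.truncn (q * m%:R)).+1},
    \sum_n (i n)%:R <= q * m%:R /\
    forall n, w n < rho `^ ((i n).+1%:R / m%:R).
Proof.
move=> m0 rho1 w1 wq; have rho0 : 0 < rho by rewrite (lt_trans ltr01).
have m0' : 0 < m%:R :> R by rewrite ltr0n.
have lnr : 0 < ln rho by rewrite ln_gt0.
have w0 n : 0 < w n by rewrite (lt_le_trans ltr01).
pose e n := m%:R * ln (w n) / ln rho.
have e0 n : 0 <= e n by rewrite divr_ge0 ?(ltW lnr)// mulr_ge0// ln_ge0.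
have sume : \sum_n e n <= q * m%:R.
  rewrite -mulr_suml -mulr_sumr -ln_prod//.
  rewrite ler_pdivrMr//.
  have -> : q * m%:R * ln rho = m%:R * (q * ln rho) by ring.
  rewrite ler_pM2l// -ln_powR ler_ln ?posrE ?powR_gt0//.
  by apply: prodr_gt0 => n _.
have tr n : (Num.truncn (e n))%:R <= e n by rewrite truncn_le.
have etot n : e n <= \sum_k e k.
  by rewrite (bigD1 n)//= lerDl sumr_ge0.
(* One share is at most the total, hence at most [q m]: this fixes the size of the grid
   independently of [rho] and [w]. *)
have bnd n : (Num.truncn (e n) < (Num.truncn (q * m%:R)).+1)%N.
  by rewrite ltnS; apply: le_truncn; apply: le_trans sume.
exists [ffun n => Ordinal (bnd n)]; split.
  apply: le_trans sume; apply: ler_sum => n _; rewrite ffunE /=; exact: tr.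
move=> n; rewrite ffunE /= -ltr_ln ?posrE ?powR_gt0// ln_powR.
rewrite mulrAC ltr_pdivlMr// mulrC -ltr_pdivrMr//.
by rewrite -/(e n) truncnS_gt.
Qed.

(** * Measurability of the outage event *)

Lemma measurable_logb (R : realType) (d : measure_display)
    (T : measurableType d) (b : R) (f : T -> R) :
  measurable_fun setT f -> measurable_fun setT (fun x => logb b (f x)).
Proof.
move=> mf; apply: measurable_funM => //.
exact: (measurableT_comp (@measurable_ln R) mf).
Qed.

Lemma measurable_idf_outage (R : realType) (d : measure_display)
    (Omega : measurableType d) (P : probability Omega R) (b rho Rs : R)
    (N : nat)
    (g0 : Omega -> R[i]) (h g : 'I_N -> Omega -> R[i]) :
  rayleigh_channel P g0 h g ->
  measurable
    [set w | idf_outage b rho Rs (g0 w) (fun n => h n w) (fun n => g n w)].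
Proof.
move=> [gauss _].
have mg0 := measurable_sqmod (gauss None).
have mh n := measurable_sqmod (gauss (Some (inl n))).
have mg n := measurable_sqmod (gauss (Some (inr n))).
(* The event is cut according to the value of the decoding set; on each of the finitely many pieces
   [S] is fixed and the capacity is a measurable expression in the gains. *)
rewrite (_ : [set w | _] = \bigcup_(S in [set: {set 'I_N}])
    ((\bigcap_(n in [set: 'I_N])
       [set w | (logb b (1 + rho * sqmod (h n w)) < 2 * Rs) = (n \notin S)]) `&`
     [set w | if #|S| == 0%N then logb b (1 + rho * sqmod (g0 w)) < Rs
              else coop_capacity b rho S (g0 w) (fun n => g n w) < Rs]));
    last first.
  apply/seteqP; split=> w /=.
    move=> H; exists (decoding_relays b rho Rs (fun n => h n w)) => //.
    split=> //.
    by move=> n _ /=; rewrite inE negbK.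
  move=> [S _ [/= HS]]; rewrite /idf_outage.
  suff -> : decoding_relays b rho Rs (fun n => h n w) = S by [].
  by apply/setP => n; rewrite inE (HS n)// negbK.
apply: fin_bigcup_measurable => [|S _]; first exact: finite_finset.
apply: measurableI.
  apply: fin_bigcap_measurable => [|n _]; first exact: finite_finset.
  apply: measurable_eqb; apply: measurable_fun_ltr => //.
  apply: measurable_logb; apply: measurable_funD => //.
  by apply: measurable_funM => //; exact: mh.
apply: measurable_set_bool; case: (#|S| == 0)%N.
  apply: measurable_fun_ltr => //.
  apply: measurable_logb; apply: measurable_funD => //.
  by apply: measurable_funM => //; exact: mg0.
apply: measurable_fun_ltr => //.
under eq_fun do rewrite coop_capacityE.
apply: measurable_funM => //; apply: measurable_logb.
under eq_fun do rewrite -big_enum /=.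
apply: measurable_prod => n _.
rewrite /relay_det; apply: measurable_funD.
  apply: measurable_funM; apply: measurable_funD => //.
    by apply: measurable_funM => //; exact: mg0.
  by apply: measurable_funM => //; apply: measurable_funM => //; exact: mg0.
by apply: measurable_funM => //; apply: measurable_funM => //; exact: mg.
Qed.

(** * Upper bound on the outage probability *)

Lemma gaussian_disc_le1 (R : realType) (t : R) : gaussian_disc t <= 1.
Proof.
rewrite -lee_fin fineK ?std_gaussian2_disc_fin//.
rewrite -[leRHS](@std_gaussian2_setT R).
by apply: le_measure; rewrite ?inE//; exact: measurable_disc.
Qed.

Lemma finite_union_bound (R : realType) (d : measure_display)
    (T : measurableType d) (mu : {measure set T -> \bar R}) (I : finType)
    (D : set I) (A : set T) (F : I -> set T) (c : R) :
  0 <= c -> measurable A -> (forall i, D i -> measurable (F i)) ->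
  A `<=` \bigcup_(i in D) F i ->
  (forall i, D i -> (mu (F i) <= c%:E)%E) -> (mu A <= (#|I|%:R * c)%:E)%E.
Proof.
move=> c0 mA mF AF Fc.
have finD : finite_set D by exact: finite_finset.
apply: le_trans (content_sub_fsum mu finD mF mA AF) _.
rewrite fsbig_mkcond (_ : setT = [set` enum I]); last first.
  by apply/seteqP; split=> i //= _; rewrite mem_enum.
rewrite -fsbig_seq ?enum_uniq// big_enum/=.
apply: (@le_trans _ _ (\sum_(i : I) c%:E)%E); last first.
  by rewrite sumEFin sumr_const mulr_natl.
(* Indices outside [D] contribute 0, which is at most [c], so all of [I] can be counted. *)
apply: lee_sum => i _; rewrite /patch.
case: ifPn => [/set_mem|_]; first exact: Fc.
by rewrite lee_fin.
Qed.

(* The exponent of the outage is spread over the links; rounding each share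
   down to a multiple of 1/m leaves finitely many ways of doing so. *)
Lemma idf_outage_sub_grid (R : realType) (Omega : Type) (b rho r : R)
    (N m : nat)
    (g0 : Omega -> R[i]) (h g : 'I_N -> Omega -> R[i]) :
  (0 < m)%N -> 1 < b -> 1 < rho ->
  let K := (Num.truncn (2 * r * N%:R * m%:R)).+1 in
  [set w | idf_outage b rho (r * logb b rho) (g0 w)
             (fun n => h n w) (fun n => g n w)]
  `<=` \bigcup_(p in [set p : {set 'I_N} * {ffun 'I_N -> 'I_K} |
                  \sum_n (p.2 n)%:R <= 2 * r * N%:R * m%:R])
    relay_discs g0 h g p.1 (2 * rho `^ (r - 1))
      (fun n => 2 * rho `^ ((p.2 n).+1%:R / m%:R - 1)).
Proof.
move=> m0 b1 rho1 K w /= H; have rho0 : 0 < rho by rewrite (lt_trans ltr01).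
pose S := decoding_relays b rho (r * logb b rho) (fun n => h n w).
have link1 n : 1 <= relay_link rho S (fun n => h n w) (fun n => g n w) n.
  by rewrite lerDl mulr_ge0// snr_ge0.
have [i [isum ilt]] :=
  prod_powR_grid m0 rho1 link1 (idf_outage_relay_links b1 rho1 H).
exists (S, i) => //=; split=> [|n]; first exact: idf_outage_direct_link H.
have := ilt n; rewrite /relay_link powRB; last first.
  by rewrite (gt_eqF rho0); apply/implyP.
rewrite powRr1 ?(ltW rho0)// mulrA ltr_pdivlMr//.
by lra.
Qed.

Lemma idf_outage_prob_upper (R : realType) (d : measure_display)
    (Omega : measurableType d) (P : probability Omega R) (b : R) (N : nat)
    (g0 : Omega -> R[i]) (h g : 'I_N -> Omega -> R[i]) (r : R) (m : nat) :
  1 < b -> rayleigh_channel P g0 h g -> (0 < m)%N ->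
  exists2 A : R, 0 < A & forall rho, 1 < rho ->
  (idf_outage_prob P b g0 h g rho (r * logb b rho) <=
  (A * rho `^ (- (Num.max (1 - r) 0 + N%:R * Num.max (1 - 2 * r) 0)
               + N%:R / m%:R))%:E)%E.
Proof.
move=> b1 ch m0; have [C0 C00 C0P] := gaussian_disc_le R.
(* [C >= 1] serves where a mass is bounded by 1, [C >= 2 * C0] where the linear bound is applied to
   a threshold [2 * rho^e]. *)
pose C := Num.max 1 (2 * C0).
have C1 : 1 <= C by rewrite le_max lexx.
have C2 : 2 * C0 <= C by rewrite le_max lexx orbT.
pose K := (Num.truncn (2 * r * N%:R * m%:R)).+1.
pose I := ({set 'I_N} * {ffun 'I_N -> 'I_K})%type.
exists (#|{: I}|%:R * (C * C ^+ N)).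
  have Cp : 0 < C by rewrite (lt_le_trans ltr01).
  rewrite mulr_gt0 ?mulr_gt0 ?exprn_gt0// ltr0n; apply/card_gt0P.
  by exists (finset.set0, [ffun=> ord0]).
move=> rho rho1; have rho0 : 0 < rho by rewrite (lt_trans ltr01).
have mE := measurable_idf_outage b rho (r * logb b rho) ch.
have powRDr x y : rho `^ (x + y) = rho `^ x * rho `^ y.
  by rewrite powRD// (gt_eqF rho0); apply/implyP.
have powr e : 0 <= rho `^ e by exact: powR_ge0.
have Fle e : gaussian_disc (2 * rho `^ e) <= C * rho `^ e.
  rewrite (le_trans (C0P _ _)) ?mulr_ge0// mulrA ler_wpM2r//.
  by rewrite mulrC.
(* For [e >= 0] the trivial bound by 1 takes over, which produces the positive part; with
   [e = r - 1] this is the direct link. *)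
have Fg e : gaussian_disc (2 * rho `^ e) <= C * rho `^ (- Num.max (- e) 0).
  rewrite maxEle; case: ifP => e0; last by rewrite opprK; exact: Fle.
  rewrite oppr0 powRr0 mulr1; exact: le_trans (gaussian_disc_le1 _) C1.
rewrite -mulrA; apply: (finite_union_bound _ mE _
  (idf_outage_sub_grid m0 b1 rho1)) => [|p _|p /= psum].
- by rewrite !mulr_ge0// ?exprn_ge0// (le_trans ler01).
- exact: (measurable_relay_discs _ _ _ ch).
rewrite rayleigh_prob_relay_discs// lee_fin.
have Cn : 0 <= C by rewrite (le_trans ler01).
have prod0 (f : 'I_N -> R) : 0 <= \prod_n gaussian_disc (f n).
  by apply: prodr_ge0 => n _; exact: gaussian_disc_ge0.
have dist : \prod_n gaussian_disc (2 * rho `^ ((p.2 n).+1%:R / m%:R - 1)) <=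
    C ^+ N * rho `^ (- (N%:R * Num.max (1 - 2 * r) 0) + N%:R / m%:R).
  (* If [1 - 2r <= 0] the relays bring no decay: the product is at most 1 and the right side at
     least 1. *)
  have [r12|r12] := leP (1 - 2 * r) 0.
    rewrite mulr0 oppr0 add0r; apply: (@le_trans _ _ 1).
      apply: (@le_trans _ _ (\prod_(n < N) 1)); last by rewrite big1_eq.
      by apply: ler_prod => n _; rewrite gaussian_disc_ge0 gaussian_disc_le1.
    rewrite -[leLHS]mulr1; apply: ler_pM => //; first exact: exprn_ege1.
    rewrite -[leLHS](powRr0 rho); apply: ler_powR; first exact: ltW.
    by rewrite divr_ge0.
  apply: (@le_trans _ _
      (\prod_n (C * rho `^ ((p.2 n).+1%:R / m%:R - 1)))).
    by apply: ler_prod => n _; rewrite gaussian_disc_ge0 Fle.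
  rewrite big_split/= prodr_const card_ord ler_wpM2l ?exprn_ge0//.
  rewrite -(big_morph (powR rho) (id1 := 1) (op1 := *%R) powRDr (powRr0 rho)).
  apply: ler_powR; first exact: ltW.
  (* The exponents sum to at most [2rN + N/m - N]: the shares give [2rN], and each [.+1] costs
     [1/m]. *)
  rewrite big_split/= -mulr_suml sumr_const card_ord.
  under eq_bigr => n _ do rewrite -natr1.
  rewrite big_split/= sumr_const card_ord.
  have m0' : 0 < m%:R :> R by rewrite ltr0n.
  have := psum; rewrite -ler_pdivrMr// => psum'.
  by rewrite mulrDl -[(- 1) *+ N]mulr_natr; lra.
have src := Fg (r - 1).
rewrite opprB in src.
apply: le_trans (ler_pM (gaussian_disc_ge0 _) (prod0 _) src dist) _.
by rewrite mulrACA -powRDr opprD addrA.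
Qed.

(** * Lower bound on the outage probability *)

Lemma idf_outage_prob_lower (R : realType) (d : measure_display)
    (Omega : measurableType d) (P : probability Omega R) (b : R) (N : nat)
    (g0 : Omega -> R[i]) (h g : 'I_N -> Omega -> R[i]) (r : R) :
  1 < b -> 0 < r -> rayleigh_channel P g0 h g ->
  exists2 A : R, 0 < A & forall rho, 1 < rho -> 2 <= rho `^ r ->
  ((A * rho `^ (- (Num.max (1 - r) 0 + N%:R * Num.max (1 - 2 * r) 0)))%:E <=
  idf_outage_prob P b g0 h g rho (r * logb b rho))%E.
Proof.
move=> b1 r0 ch; have [c c0 cP] := gaussian_disc_ge R.
(* One factor [c / 2] for the direct link and one for each of the [N] source links. *)
exists ((c / 2) ^+ N.+1); first by rewrite exprn_gt0// divr_gt0.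
move=> rho rho1 rho2; have rho0 : 0 < rho by rewrite (lt_trans ltr01).
have powRDr x y : rho `^ (x + y) = rho `^ x * rho `^ y.
  by rewrite powRD// (gt_eqF rho0); apply/implyP.
have Fge s : 2 <= rho `^ s ->
    c / 2 * rho `^ (- Num.max (1 - s) 0) <=
    gaussian_disc ((rho `^ s - 1) / rho).
  move=> s2; set t := - Num.max _ _.
  have t0 : t <= 0 by rewrite oppr_le0 le_max lexx orbT.
  have ts : t <= s - 1 by rewrite -[leRHS]opprB lerN2 le_max lexx.
  have pt1 : rho `^ t <= 1.
    by rewrite -[leRHS](powRr0 rho); apply: ler_powR => //; exact: ltW.
  have pt0 : 0 <= rho `^ t by exact: powR_ge0.
  (* As [t] is the minimum of [s - 1] and 0, the threshold [rho^t / 2] stays in [[0, 1]], where the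
     linear lower bound holds; it is below the actual one because [rho^s >= 2] gives
     [rho^s - 1 >= rho^s / 2]. *)
  rewrite -mulrA; apply: (@le_trans _ _ (gaussian_disc (2^-1 * rho `^ t))).
    by apply: cP; lra.
  apply: gaussian_disc_mono.
  have tr : rho `^ t <= rho `^ s / rho.
    rewrite -[rho^-1]powR_inv1 ?(ltW rho0)// -powRDr.
    by apply: ler_powR => //; exact: ltW.
  apply: (@le_trans _ _ (2^-1 * (rho `^ s / rho))); first by rewrite ler_wpM2l.
  by rewrite mulrA ler_pM2r ?invr_gt0//; lra.
have rho2' : 2 <= rho `^ (2 * r).
  by apply: (le_trans rho2); apply: ler_powR; [exact: ltW|lra].
pose E := relay_discs g0 h g finset.set0 ((rho `^ r - 1) / rho)
  (fun=> (rho `^ (2 * r) - 1) / rho).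
apply: (@le_trans _ _ (P E)); last first.
  apply: le_measure; rewrite ?inE.
  - exact: (measurable_relay_discs _ _ _ ch).
  - exact: (measurable_idf_outage _ _ _ ch).
  - move=> w [H1 H2]; apply: idf_outage_no_decoding => // n.
    by have := H2 n; rewrite finset.in_set0.
rewrite rayleigh_prob_relay_discs// lee_fin prodr_const card_ord.
rewrite exprS opprD powRDr mulrACA.
have -> : - (N%:R * Num.max (1 - 2 * r) 0) = (- Num.max (1 - 2 * r) 0) * N%:R.
  by rewrite mulNr mulrC.
rewrite [rho `^ (_ * N%:R)]powRrM powR_mulrn ?powR_ge0// -exprMn.
have pos s : 0 <= c / 2 * rho `^ s.
  by rewrite mulr_ge0 ?powR_ge0// ltW// divr_gt0.
apply: ler_pM => //; rewrite ?exprn_ge0//; first exact: Fge.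
by apply: lerXn2r; rewrite ?nnegrE ?gaussian_disc_ge0//; exact: Fge.
Qed.

(** * Passage to the limit *)

Theorem theorem2 (R : realType) (d : measure_display)
    (Omega : measurableType d) (P : probability Omega R) (b : R) (hb : 1 < b)
    (N : nat) (g0 : Omega -> R[i]) (h g : 'I_N -> Omega -> R[i])
    (hch : rayleigh_channel P g0 h g) (r : R) (hr : 0 < r) :
  achieves_diversity b (idf_outage_prob P b g0 h g) r
    (Num.max (1 - r) 0 + N%:R * Num.max (1 - 2 * r) 0).
Proof.
rewrite /achieves_diversity; set D := _ + _.
pose Pr rho := idf_outage_prob P b g0 h g rho (r * logb b rho).
have lnD M : \forall rho \near +oo%R, M < ln rho.
  near=> rho.
  have Mrho : expR M < rho by near: rho; exact: nbhs_pinfty_gt.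
  have rho0 : 0 < rho by rewrite (lt_trans _ Mrho) ?expR_gt0.
  by rewrite -[ltLHS]expRK ltr_ln ?posrE ?expR_gt0.
have [A A0 AP] := idf_outage_prob_lower hb hr hch.
have PrE rho : Pr rho = (fine (Pr rho))%:E.
  rewrite fineK// /Pr; apply: fin_num_measure.
  exact: (measurable_idf_outage _ _ _ hch).
have big : \forall rho \near +oo%R,
    [/\ 1 < rho, 2 <= rho `^ r & 0 < fine (Pr rho)].
  near=> rho.
  have rho1 : 1 < rho by near: rho; exact: nbhs_pinfty_gt.
  (* Positivity of [r] makes [rho^r] unbounded, as the lower bound requires. *)
  have rho2 : 2 <= rho `^ r.
    rewrite -ler_ln ?posrE ?powR_gt0 ?(lt_trans ltr01 rho1)// ln_powR.
    by rewrite -ler_pdivrMl// ltW//; near: rho; exact: lnD.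
  split=> //; have := AP rho rho1 rho2; rewrite -/(Pr rho) PrE lee_fin.
  by apply: lt_le_trans; rewrite mulr_gt0// powR_gt0// (lt_trans ltr01).
(* The probability is eventually positive, so the extended logarithm is finite and the ratio of
   logarithms no longer depends on [b]. *)
apply: (@cvg_trans _ ((ln (fine (Pr rho)) / ln rho)%:E @[rho --> +oo%R])).
  apply: near_eq_cvg; near=> rho.
  have [rho1 _ Pr0] : [/\ 1 < rho, 2 <= rho `^ r & 0 < fine (Pr rho)].
    by near: rho; exact: big.
  rewrite -/(Pr rho) PrE /elogb lne_EFin// -!EFinM /logb; congr (_%:E).
  have lnb0 : ln b != 0 by rewrite gt_eqF// ln_gt0.
  have lnr0 : ln rho != 0 by rewrite gt_eqF// ln_gt0.
  by field; rewrite lnb0.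
apply: cvg_EFin; first by near=> rho.
apply/cvgrPdist_le => e e0.
(* The rounding loss [N / m] uses half of [e], the constant [B] the other half; the lower bound has
   no rounding loss and leaves all of [e] to [A]. *)
pose m := (Num.truncn (2 * N%:R / e)).+1.
have Nm : N%:R / m%:R <= e / 2.
  have m0 : 0 < m%:R :> R by rewrite ltr0n.
  have : 2 * N%:R / e < m%:R by exact: truncnS_gt.
  by rewrite ltr_pdivrMr// ler_pdivrMr//; lra.
have [B B0 BP] := idf_outage_prob_upper r hb hch (isT : (0 < m)%N).
near=> rho.
have [rho1 rho2 Pr0] : [/\ 1 < rho, 2 <= rho `^ r & 0 < fine (Pr rho)].
  by near: rho; exact: big.
have rho0 : 0 < rho by rewrite (lt_trans ltr01).
have lnr0 : 0 < ln rho by rewrite ln_gt0.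
have lnA : - ln A <= e * ln rho.
  by rewrite -ler_pdivrMl// ltW//; near: rho; exact: lnD.
have lnB : ln B <= e / 2 * ln rho.
  by rewrite -ler_pdivrMl ?divr_gt0// ltW//; near: rho; exact: lnD.
have := AP rho rho1 rho2; have := BP rho rho1.
rewrite -/(Pr rho) PrE !lee_fin.
rewrite -ler_ln ?posrE ?mulr_gt0 ?powR_gt0// => up.
rewrite -ler_ln ?posrE ?mulr_gt0 ?powR_gt0// => lo.
move: up lo; rewrite !lnM ?posrE ?powR_gt0// !ln_powR -/D => up lo.
have NL : N%:R / m%:R * ln rho <= e / 2 * ln rho by rewrite ler_wpM2r// ltW.
rewrite ler_distl; apply/andP; split.
  by rewrite lerBlDr ler_pdivrMr//; lra.
by rewrite -lerBlDr ler_pdivlMr//; lra.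
Unshelve. all: by end_near.
Qed.
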